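(* Let $S$ be a semigroup with left cancellation law such that $C(S)$ is nonnilpotent. Then the following conditions are equivalent: (i) $T(S)$ is an ideal of $S$. (ii) $T(S)=\beta(S)$. (iii) $\beta(S)$ is a completely prime ideal of $S$.
   Context: ''Semigroup'' means a (not necessarily commutative) semigroup $S$ with unit element $1$ and zero element $0$, $1\neq 0$. ''Ideal'' means two-sided ideal; products of subsets are sets of elementwise products. $S$ has left cancellation law if for all $a,b,c\in S$, $ab=ac\neq 0$ implies $b=c$. A proper right ideal (in particular, a proper ideal) $P$ is prime if for all $a,b\in S$, $aSb\subseteq P$ implies $a\in P$ or $b\in P$; it is completely prime if $ab\in P$ implies $a\in P$ or $b\in P$. A right ideal $I$ of $S$ is a right comparizer if for all right ideals $A,B$ of $S$, either $A\subseteq B$ or $BI\subseteq A$ (equivalently, for all $a,b\in S$, either $aS\subseteq bS$ or $bI\subseteq aS$). $C(S)$ denotes the union of all proper right comparizer ideals of $S$. A right ideal $I$ is nilpotent if $I^n=0$ for some $n\ge 1$. $T(S)$ is the set of all nilpotent elements of $S$; $\beta(S)$ (the prime radical) is the intersection of all prime ideals of $S$. *)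

(* Defs.v *)
From HB Require Import structures.
From mathcomp Require Import all_boot.
From mathcomp Require Import boolp classical_sets.

Set Implicit Arguments.
Unset Strict Implicit.
Unset Printing Implicit Defensive.

Local Open Scope classical_set_scope.
Local Open Scope group_scope.

(* Monoids with an absorbing element distinct from the unit. The choiceType
   structure carried by monoidType is no restriction: classically every type
   has one (boolp.gen_eqMixin, boolp.gen_choiceMixin). *)
HB.mixin Record Monoid_hasZero S of Monoid S := {
  zerog : S;
  mul0g : left_zero zerog (@mul S);
  mulg0 : right_zero zerog (@mul S);
  oneg_neq0 : (1 : S) <> zerog
}.

#[short(type="monoid0Type")]
HB.structure Definition Monoid0 := {S of Monoid_hasZero S & Monoid S}.

Arguments zerog {s}.

Section Ideals.
Variable S : monoid0Type.
Implicit Types (a b x : S) (A B I P : set S).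

Definition left_cancellation : Prop :=
  forall a b c : S, a * b = a * c -> a * b <> zerog -> b = c.

Definition set_prod A B : set S := [set x * y | x in A & y in B].

Fixpoint set_pow A (n : nat) : set S :=
  if n is m.+1 then set_prod A (set_pow A m) else [set 1].

Definition right_ideal I : Prop :=
  I !=set0 /\ set_prod I [set: S] `<=` I.

Definition ideal I : Prop :=
  right_ideal I /\ set_prod [set: S] I `<=` I.

Definition proper I : Prop := I <> [set: S].

Definition prime_right_ideal P : Prop :=
  [/\ right_ideal P, proper P &
      forall a b, set_prod (set_prod [set a] [set: S]) [set b] `<=` P ->
        P a \/ P b].

Definition completely_prime_right_ideal P : Prop :=
  [/\ right_ideal P, proper P & forall a b, P (a * b) -> P a \/ P b].

Definition prime_ideal P : Prop := ideal P /\ prime_right_ideal P.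

Definition completely_prime_ideal P : Prop :=
  ideal P /\ completely_prime_right_ideal P.

Definition right_comparizer I : Prop :=
  right_ideal I /\
  forall A B, right_ideal A -> right_ideal B ->
    A `<=` B \/ set_prod B I `<=` A.

(* "Ideal" is two-sided here. Ranging over right ideals instead would give the
   same union under left cancellation: if I is a proper right ideal that is a
   right comparizer, then so is the two-sided ideal S I, which contains I and
   is proper. *)
Definition comparizer_union : set S :=
  \bigcup_(I in [set I | [/\ ideal I, proper I & right_comparizer I]]) I.

Definition nilpotent_set I : Prop :=
  exists2 n, 0 < n & set_pow I n = [set zerog].

Definition nilpotent_elements : set S :=
  [set x | exists2 n, 0 < n & x ^+ n = zerog].

Definition prime_radical : set S := \bigcap_(P in [set P | prime_ideal P]) P.

End Ideals.

Arguments comparizer_union S : clear implicits.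
Arguments nilpotent_elements S : clear implicits.
Arguments prime_radical S : clear implicits.

(* Main.v *)
(** Write [T] for the nilpotent elements, [I] for the union of the proper right
    comparizer ideals (again a right comparizer ideal), and suppose that [T] is
    an ideal.

    A nilpotent [z] satisfies [z u I <= u S] for every [u]: otherwise
    [u = z u s], hence [u = z^n u s^n = 0].  Consequently, for [t] in [T], every
    further factor from [T t I] raises the power of [t] dividing a product on
    the left, so [t (T t I)^n = 0] for large [n], and a prime ideal [P]
    contains [t] or [I].

    If [a] lies outside an ideal [P] containing [I], then [a] is in no [x S]
    with [x] in [I], so [x I <= a S]; that is, [I^2 <= a S].  Powers of such
    inclusions put powers of [I] inside [w S] for every product [w] of elements
    outside [P].  As [I] is not nilpotent, no such [w] vanishes, so [P]
    contains [T], and [T], if it contains [I], is completely prime.  If [T] does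
    not contain [I], complete primeness follows because [T] is completely
    semiprime and [a b] in [T] with [a], [b] outside [T] forces [b I <= T]. *)

Require Import Defs.
From mathcomp Require Import all_boot.
From mathcomp Require Import boolp classical_sets.

Set Implicit Arguments.
Unset Strict Implicit.
Unset Printing Implicit Defensive.

Section Semigroup.
Local Open Scope classical_set_scope.
Local Open Scope group_scope.
Variable S : monoid0Type.
Implicit Types (a b c s t u v x y z : S) (A I P : set S).

Local Notation "0" := (@zerog S) : group_scope.
Local Notation T := (nilpotent_elements S).

(** * Principal right ideals and elementwise forms of the definitions *)

Definition rmultiples a : set S := [set b | exists r, b = a * r].

Lemma rmultiples_right_ideal a : right_ideal (rmultiples a).
Proof.
split; first by exists a, 1; rewrite mulg1.
by move=> _ [_ [r ->] [s _ <-]]; exists (r * s); rewrite mulgA.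
Qed.

Lemma rmultiples0 x : rmultiples 0 x -> x = 0.
Proof. by case=> r ->; rewrite mul0g. Qed.

Lemma ideal_mulr I x s : ideal I -> I x -> I (x * s).
Proof. by move=> [[_ IS] _] Ix; apply: IS; exists x => //; exists s. Qed.

Lemma ideal_mull I s x : ideal I -> I x -> I (s * x).
Proof. by move=> [_ SI] Ix; apply: SI; exists s => //; exists x. Qed.

Lemma ideal0 I : ideal I -> I 0.
Proof.
by move=> idI; case: (idI) => -[[x Ix] _] _; rewrite -(mulg0 x); apply: ideal_mulr.
Qed.

Lemma idealP I :
  I 0 -> (forall x s, I x -> I (x * s)) -> (forall s x, I x -> I (s * x)) ->
  ideal I.
Proof.
move=> I0 IS SI; split; first split; first by exists 0.
  by move=> _ [x Ix [s _ <-]]; apply: IS.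
by move=> _ [s _ [x Ix <-]]; apply: SI.
Qed.

Lemma right_comparizer_mul I a b : right_comparizer I ->
  rmultiples b a \/ forall x, I x -> rmultiples a (b * x).
Proof.
move=> [_ cI].
have [aS_bS|bI_aS] :=
  cI _ _ (rmultiples_right_ideal a) (rmultiples_right_ideal b).
  by left; apply: aS_bS; exists 1; rewrite mulg1.
right=> x Ix; apply: bI_aS; exists b; first by exists 1; rewrite mulg1.
by exists x.
Qed.

Lemma prime_ideal_mul P a b : prime_ideal P -> ~ P a -> ~ P b ->
  exists r, ~ P (a * r * b).
Proof.
move=> [_ [_ _ primeP]] nPa nPb; apply/not_existsP => aSbP.
have [] // := primeP a b.
by move=> _ [_ [_ -> [r _ <-]] [_ -> <-]]; apply: contrapT; apply: aSbP.
Qed.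

(** * The union of the comparizer ideals *)

Lemma zero_comparizer : right_comparizer [set 0].
Proof.
split; first split; first by exists 0.
  by move=> _ [_ -> [s _ <-]]; rewrite mul0g.
move=> A B [[a Aa] AS] _; right => _ [b _ [_ -> <-]].
by apply: AS; exists a => //; exists 0 => //; rewrite !mulg0.
Qed.

Lemma comparizer_union_ideal : ideal (comparizer_union S).
Proof.
have id0 : ideal [set 0].
  by apply: idealP => // [x s ->|s x ->]; rewrite ?mul0g ?mulg0.
apply: idealP.
- exists [set 0] => //; split=> //; last exact: zero_comparizer.
  by move=> set0T; have : [set: S] 1 by []; rewrite -set0T => /oneg_neq0.
- by move=> x s [I [idI pI cI] Ix]; exists I; [split|apply: ideal_mulr].
- by move=> s x [I [idI pI cI] Ix]; exists I; [split|apply: ideal_mull].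
Qed.

(** The alternative [A <= B] does not mention the comparizer, so if it fails, every ideal in the
    union satisfies the other one. *)
Lemma comparizer_union_comparizer : right_comparizer (comparizer_union S).
Proof.
have [rI _] := comparizer_union_ideal; split=> // A B rA rB.
have [|nAB] := pselect (A `<=` B); [by left|right].
move=> _ [b Bb [x [I [idI pI cI] Ix] <-]].
case: cI => _ /(_ A B rA rB)[//|]; apply.
by exists b => //; exists x.
Qed.

(** * Powers of an ideal inside principal right ideals *)

Section PowersDivisible.
Variable I : set S.

(** The free left factor [s] makes divisibility multiplicative: it absorbs the cofactor left by [u]
    before [v] is divided out. *)
Definition pow_divisible m u :=
  forall s y, set_pow I m y -> rmultiples u (s * y).

Lemma pow_divisible0 : pow_divisible 0%N 1.
Proof. by move=> s y _; exists (s * y); rewrite mul1g. Qed.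

Lemma set_powD m n y : set_pow I (m + n)%N y ->
  exists2 y1, set_pow I m y1 & exists2 y2, set_pow I n y2 & y = y1 * y2.
Proof.
elim: m y => [|m IHm] y; first by move=> Iy; exists 1 => //; exists y; rewrite ?mul1g.
rewrite addSn => -[x Ix [_ /IHm[y1 Iy1 [y2 Iy2 ->]] <-]].
by exists (x * y1); [exists x => //; exists y1|exists y2; rewrite ?mulgA].
Qed.

Lemma pow_divisibleM m n u v :
  pow_divisible m u -> pow_divisible n v -> pow_divisible (m + n)%N (u * v).
Proof.
move=> div_u div_v s _ /set_powD[y1 Iy1 [y2 Iy2 ->]].
have [r1 E1] := div_u s _ Iy1; have [r2 E2] := div_v r1 _ Iy2.
by exists r2; rewrite mulgA E1 -mulgA E2 mulgA.
Qed.

Lemma pow_divisibleX m u k :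
  pow_divisible m u -> pow_divisible (k * m)%N (u ^+ k).
Proof.
move=> div_u; elim: k => [|k IHk]; first exact: pow_divisible0.
by rewrite mulSn expgS; apply: pow_divisibleM.
Qed.

Lemma set_pow0 m : I 0 -> set_pow I m.+1 0.
Proof.
move=> I0; elim: m => [|m IHm]; first by exists 0 => //; exists 1; rewrite ?mul0g.
by exists 0 => //; exists 0; rewrite ?mul0g.
Qed.

Lemma pow_divisible_nilpotent m u : I 0 -> (0 < m)%N ->
  pow_divisible m u -> T u -> nilpotent_set I.
Proof.
case: m => // m I0 _ div_u [k k_gt0 uk0]; exists (k * m.+1)%N.
  by rewrite muln_gt0 k_gt0.
apply/seteqP; split=> [y Iy|_ ->]; last first.
  (* Positive exponents matter: the zeroth power is the singleton of 1 and lacks 0. *)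
  by case: k k_gt0 {uk0} => // k _; rewrite mulSn addSn; apply: set_pow0.
have := pow_divisibleX (k := k) div_u; rewrite uk0 => /(_ 1 y Iy).
by rewrite mul1g => /rmultiples0.
Qed.

End PowersDivisible.

(** * Nilpotent elements and a comparizer ideal *)

Section Comparizer.
Variable I : set S.
Hypotheses (idI : ideal I) (cI : right_comparizer I).

Lemma pow_divisible_notin P a : ideal P -> I `<=` P -> ~ P a ->
  pow_divisible I 2 a.
Proof.
move=> idP IP nPa s _ [x Ix [_ [y Iy [_ -> <-]] <-]].
rewrite mulg1 mulgA; have Isx := ideal_mull s idI Ix.
(* The exponent is 2 because [x] keeps the multiples of [s * x] inside [P], while [y] is the factor
   that the comparizer property requires. *)
have [[r aE]|] := right_comparizer_mul a (s * x) cI; last exact.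
by case: nPa; rewrite aE; apply: (ideal_mulr _ idP); apply: IP.
Qed.

Lemma nilpotent_mul_comparizer z u x : T z -> I x ->
  rmultiples u (z * u * x).
Proof.
move=> [n _ zn0] Ix.
have [[s uE]|] := right_comparizer_mul u (z * u) cI; last exact.
suff -> : u = 0 by rewrite mulg0 mul0g; exists 0; rewrite mulg0.
have {}uE k : u = z ^+ k * u * s ^+ k.
  elim: k => [|k IHk]; first by rewrite mul1g mulg1.
  by rewrite expgSr expgS {1}IHk {1}uE !mulgA.
by rewrite (uE n) zn0 !mul0g.
Qed.

Hypothesis idT : ideal T.

Lemma prime_comparizer_or_nilpotent P t : prime_ideal P -> T t ->
  I `<=` P \/ P t.
Proof.
move=> primeP Tt; have [idP _] := primeP.
have [|/existsNP[c /not_implyP[Ic nPc]]] := pselect (I `<=` P); first by left.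
right; apply: contrapT => nPt.
(* Primeness extends [t ^+ k * s] to [t ^+ k * (s * r1 * t * r2) * t * (r3 * c)], still outside [P].
   The first new [t] makes the bracket nilpotent, so the second can be pulled out in front of it. *)
have power_notin k : exists s, ~ P (t ^+ k * s).
  elim: k => [|k [s nPts]]; first by exists t; rewrite mul1g.
  have [r1 nPr1] := prime_ideal_mul primeP nPts nPt.
  have [r2 nPr2] := prime_ideal_mul primeP nPr1 nPt.
  have [r3 nPr3] := prime_ideal_mul primeP nPr2 nPc.
  have Tsr : T (s * r1 * t * r2).
    by apply: ideal_mulr => //; apply: ideal_mull.
  have [s' E] := nilpotent_mul_comparizer t Tsr (ideal_mull r3 idI Ic).
  exists s'; apply: contra_not nPr3; rewrite expgSr -(mulgA _ t) -E.
  by rewrite !mulgA.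
have [n _ tn0] := Tt; have [s] := power_notin n.
by rewrite tn0 mul0g; apply; apply: ideal0.
Qed.

Hypothesis nnI : ~ nilpotent_set I.

Lemma nilpotent_elements_sub_prime P : prime_ideal P -> T `<=` P.
Proof.
move=> primeP t Tt.
have [IP|//] := prime_comparizer_or_nilpotent primeP Tt.
apply: contrapT => nPt; apply: nnI.
apply: (pow_divisible_nilpotent (m := 2) (ideal0 idI) _ _ Tt) => //.
exact: (pow_divisible_notin primeP.1 IP nPt).
Qed.

Lemma nilpotent_sqr x : T (x * x) -> T x.
Proof.
move=> [n n_gt0 xxn0]; exists (2 * n)%N; first by rewrite muln_gt0.
by rewrite expgnA expg2.
Qed.

(** The square of [b * a] is [b * (a * b) * a]. *)
Lemma nilpotent_mulC a b : T (a * b) -> T (b * a).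
Proof.
move=> Tab; apply: nilpotent_sqr.
by rewrite mulgA -(mulgA b); apply: ideal_mulr => //; apply: ideal_mull.
Qed.

Lemma nilpotent_insert a s b : T (a * b) -> T (a * s * b).
Proof.
move=> /nilpotent_mulC Tba; apply: nilpotent_sqr.
have -> : a * s * b * (a * s * b) = a * s * (b * a) * (s * b).
  by rewrite !mulgA.
by apply: ideal_mulr => //; apply: ideal_mull.
Qed.

Lemma nilpotent_mul_comparizer_absorb a b x :
  T (a * b) -> ~ T a -> I x -> T (b * x).
Proof.
move=> Tab nTa Ix; have [[s aE]|bI_aS] := right_comparizer_mul a b cI.
  (* If [a = b * s], then [a * a = a * b * s] is in [T]. *)
  case: nTa; apply: nilpotent_sqr; rewrite {2}aE mulgA.
  exact: ideal_mulr.
have [r bxE] := bI_aS x Ix; apply: nilpotent_sqr.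
by rewrite {1}bxE mulgA; apply: ideal_mulr => //; apply: nilpotent_insert.
Qed.

Lemma nilpotent_elements_mul a b : T (a * b) -> T a \/ T b.
Proof.
move=> Tab; apply: contrapT => /not_orP[nTa nTb].
have [IT|/existsNP[c /not_implyP[Ic nTc]]] := pselect (I `<=` T).
  apply: nnI; apply: (pow_divisible_nilpotent (m := 2 + 2) (ideal0 idI) _ _ Tab) => //.
  by apply: pow_divisibleM; apply: (pow_divisible_notin idT IT).
have Tbc := nilpotent_mul_comparizer_absorb Tab nTa Ic.
(* The same absorption, now with [b * c] in [T] and [b] outside it, puts [c * c] in [T]. *)
by apply: nTc; apply: nilpotent_sqr; apply: nilpotent_mul_comparizer_absorb Tbc _ _.
Qed.

End Comparizer.

(** * The prime radical and nilpotency *)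

Lemma prime_radical_ideal : ideal (prime_radical S).
Proof.
apply: idealP => [P [idP _]|x s bx P primeP|s x bx P primeP].
- exact: ideal0.
- by apply: ideal_mulr; [case: primeP|apply: bx].
- by apply: ideal_mull; [case: primeP|apply: bx].
Qed.

(* Unions of ideals are ideals, so no choice is needed to get an ideal maximal
   among those avoiding the powers of [x]. *)
Lemma prime_radical_nilpotent : prime_radical S `<=` T.
Proof.
move=> x bx; apply: contrapT => nTx.
have xn0 n : x ^+ n <> 0.
  case: n => [|n xn0]; first exact: oneg_neq0.
  by apply: nTx; exists n.+1.
pose avoids A := forall n, ~ A (x ^+ n).
pose M : set S := \bigcup_(A in [set A | ideal A /\ avoids A]) A.
have MI A : ideal A -> avoids A -> A `<=` M by move=> idA avA y Ay; exists A.
have avM : avoids M by move=> n [A [_ avA] /avA].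
have idM : ideal M.
  apply: idealP => [|y s [A [idA avA] Ay]|s y [A [idA avA] Ay]].
  - apply: (MI [set 0]) => //.
    by apply: idealP => // [y s ->|s y ->]; rewrite ?mul0g ?mulg0.
  - by apply: (MI A) => //; apply: ideal_mulr.
  - by apply: (MI A) => //; apply: ideal_mull.
(* By maximality, adjoining [S a S] to [M] must capture a power of [x]. *)
have power_multiple a : ~ M a -> exists n s r, x ^+ n = s * a * r.
  move=> nMa; apply: contrapT => no_power; apply: nMa.
  pose A : set S := [set y | M y \/ exists s r, y = s * a * r].
  apply: (MI A); last by right; exists 1, 1; rewrite mul1g mulg1.
    apply: idealP => [|y u [My|[s [r ->]]]|u y [My|[s [r ->]]]].
    - by left; apply: ideal0.
    - by left; apply: ideal_mulr.
    - by right; exists s, (r * u); rewrite !mulgA.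
    - by left; apply: ideal_mull.
    - by right; exists (u * s), r; rewrite !mulgA.
  move=> n [/avM//|[s [r xnE]]].
  by apply: no_power; exists n, s, r.
have primeM : prime_ideal M.
  split=> //; split; [by case: idM| |].
    by move=> MT; apply: (avM 1%N); rewrite MT.
  move=> a b aSbM; apply: contrapT => /not_orP[].
  move=> /power_multiple[n [s [r xnE]]] /power_multiple[m [u [v xmE]]].
  apply: (avM (n + m)%N); rewrite expgnDr xnE xmE.
  have -> : s * a * r * (u * b * v) = s * (a * (r * u) * b) * v.
    by rewrite !mulgA.
  apply: ideal_mulr => //; apply: ideal_mull => //; apply: aSbM.
  by exists (a * (r * u)); [exists a => //; exists (r * u)|exists b].
by apply: (avM 1%N); apply: bx.
Qed.

Lemma prime_radical_eq : T `<=` prime_radical S -> T = prime_radical S.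
Proof. by move=> TB; apply/seteqP; split=> //; apply: prime_radical_nilpotent. Qed.

Lemma completely_prime_prime_radical :
  completely_prime_ideal (prime_radical S) -> T = prime_radical S.
Proof.
move=> [idB [_ pB cpB]]; apply: prime_radical_eq => x [n _ xn0].
have : prime_radical S (x ^+ n) by rewrite xn0; exact: (ideal0 idB).
(* The exponent descends by complete primeness; at exponent 0 the radical contains 1, hence [x]. *)
elim: n {xn0} => [B1|n IHn]; last by rewrite expgS => /cpB[].
by rewrite -(mul1g x); apply: (ideal_mulr _ idB).
Qed.

Lemma nilpotent_elements_proper : Defs.proper T.
Proof.
move=> TT; have [n _] : T 1 by rewrite TT.
by rewrite expg1n => /oneg_neq0.
Qed.

End Semigroup.

Theorem theorem2p10 (S : monoid0Type)
    (hcancel : left_cancellation S)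
    (hC : ~ nilpotent_set (comparizer_union S)) :
  (ideal (nilpotent_elements S) <-> nilpotent_elements S = prime_radical S) /\
  (nilpotent_elements S = prime_radical S <->
     completely_prime_ideal (prime_radical S)).
Proof.
have idC := comparizer_union_ideal S.
have cC := @comparizer_union_comparizer S.
have TE : ideal (nilpotent_elements S) ->
    nilpotent_elements S = prime_radical S.
  move=> idT; apply: prime_radical_eq => t Tt P primeP.
  exact: (nilpotent_elements_sub_prime idC cC idT hC primeP Tt).
have idB := prime_radical_ideal S.
split; split=> //; first by move=> ->.
  move=> TB; rewrite -TB in idB *; split=> //.
  split; [by case: idB|exact: nilpotent_elements_proper|].
  exact: (nilpotent_elements_mul idC cC idB hC).
exact: completely_prime_prime_radical.
Qed.
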